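(* Let $\mathfrak g$ be a $2$-step solvable, unimodular, completely solvable Lie algebra endowed with a complex structure $J$ and admitting an SKT metric compatible with $J$. Then there exists $p\ge 0$ such that $$\mathfrak g=\mathfrak{aff}(\mathbb R)^p\ltimes \mathfrak n_J,$$ where $\mathfrak n_J$ is the maximal $J$-invariant nilpotent ideal of $\mathfrak g$.
   Context: All Lie algebras are finite-dimensional and real. A complex structure on $\mathfrak g$ is $J\in\mathrm{End}(\mathfrak g)$ with $J^2=-\mathrm{Id}$ and $[X,Y]+J[JX,Y]+J[X,JY]-[JX,JY]=0$ for all $X,Y$. $2$-step solvable means $[\mathfrak g',\mathfrak g']=0$ with $\mathfrak g'=[\mathfrak g,\mathfrak g]$; unimodular means $\mathrm{tr}(\mathrm{ad}_X)=0$ for all $X$; completely solvable means that $\mathfrak g$ is solvable and all eigenvalues of $\mathrm{ad}_X$ are real for every $X\in\mathfrak g$. An SKT metric compatible with $J$ is an inner product $g$ on $\mathfrak g$ with $g(J\cdot,J\cdot)=g(\cdot,\cdot)$ such that $\omega=g(J\cdot,\cdot)$ satisfies $dd^c\omega=0$, where $d$ is the Chevalley–Eilenberg differential and $d^c=J^{-1}dJ$ (with $J$ acting on forms). $\mathfrak{aff}(\mathbb R)$ is the Lie algebra $\langle X,JX\rangle$ with $[JX,X]=X$, with the indicated complex structure, and $\mathfrak{aff}(\mathbb R)^p$ is the direct sum of $p$ copies. The notation $\mathfrak g=\mathfrak{aff}(\mathbb R)^p\ltimes\mathfrak n_J$ means that there is a $J$-invariant subalgebra $\mathfrak h$ of $\mathfrak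 g$, isomorphic to $\mathfrak{aff}(\mathbb R)^p$ as a Lie algebra with complex structure, such that $\mathfrak g=\mathfrak h\oplus\mathfrak n_J$ as vector spaces ($\mathfrak n_J$ being an ideal). *)

(* Defs.v *)
From HB Require Import structures.
From mathcomp Require Import all_boot all_order all_algebra.
From mathcomp Require Import sesquilinear complex reals ring.

Set Implicit Arguments.
Unset Strict Implicit.
Unset Printing Implicit Defensive.

Import Order.TTheory GRing.Theory Num.Theory.
Local Open Scope ring_scope.

HB.mixin Record isLieAlgebra (R : fieldType) (g : Type) of Vector R g := {
  lieb : g -> g -> g;
  lieb_linearl : forall y, linear (lieb^~ y);
  lieb_linearr : forall x, linear (lieb x);
  liebxx : forall x, lieb x x = 0;
  lieb_jacobi : forall x y z,
    lieb x (lieb y z) + lieb y (lieb z x) + lieb z (lieb x y) = 0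
}.

#[short(type="lieAlgType")]
HB.structure Definition LieAlgebra (R : fieldType) :=
  { g of isLieAlgebra R g & Vector R g }.

HB.instance Definition _ (R : fieldType) (g : lieAlgType R) :=
  bilinear_isBilinear.Build R g g g *:%R *:%R (@lieb R g)
    (@lieb_linearl R g, @lieb_linearr R g).

Section DirectPower.
Variables (R : fieldType) (I : finType) (g : lieAlgType R).

Definition ffun_lieb (x y : {ffun I -> g}) : {ffun I -> g} :=
  [ffun i => lieb (x i) (y i)].

Fact ffun_lieb_linearl y : linear (ffun_lieb^~ y).
Proof. by move=> a u v; apply/ffunP => i; rewrite !ffunE linearPl. Qed.

Fact ffun_lieb_linearr x : linear (ffun_lieb x).
Proof. by move=> a u v; apply/ffunP => i; rewrite !ffunE linearPr. Qed.

Fact ffun_liebxx x : ffun_lieb x x = 0.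
Proof. by apply/ffunP => i; rewrite !ffunE liebxx. Qed.

Fact ffun_lieb_jacobi x y z :
  ffun_lieb x (ffun_lieb y z) + ffun_lieb y (ffun_lieb z x)
  + ffun_lieb z (ffun_lieb x y) = 0.
Proof. by apply/ffunP => i; rewrite !ffunE lieb_jacobi. Qed.

HB.instance Definition _ := isLieAlgebra.Build R {ffun I -> g}
  ffun_lieb_linearl ffun_lieb_linearr ffun_liebxx ffun_lieb_jacobi.
End DirectPower.

(* The pair (x, y) stands for x X + y JX, where [JX, X] = X. *)
Definition aff (R : fieldType) : Type := (R^o * R^o)%type.
HB.instance Definition _ (R : fieldType) := Vector.on (aff R).

Section Aff.
Variable R : fieldType.

Definition aff_lieb (u v : aff R) : aff R :=
  (u.2 * v.1 - u.1 * v.2 : R, 0 : R).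

Definition aff_J (u : aff R) : aff R := (- u.2, u.1).

Fact aff_lieb_linearl v : linear (aff_lieb^~ v).
Proof.
move=> a u w; apply/pair_equal_spec; split => /=; last by rewrite scaler0 addr0.
by rewrite /GRing.scale /=; ring.
Qed.

Fact aff_lieb_linearr u : linear (aff_lieb u).
Proof.
move=> a v w; apply/pair_equal_spec; split => /=; last by rewrite scaler0 addr0.
by rewrite /GRing.scale /=; ring.
Qed.

Fact aff_liebxx u : aff_lieb u u = 0.
Proof. by apply/pair_equal_spec; split => //=; ring. Qed.

Fact aff_lieb_jacobi u v w :
  aff_lieb u (aff_lieb v w) + aff_lieb v (aff_lieb w u)
  + aff_lieb w (aff_lieb u v) = 0.
Proof. by apply/pair_equal_spec; split => /=; ring. Qed.

HB.instance Definition _ := isLieAlgebra.Build R (aff R)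
  aff_lieb_linearl aff_lieb_linearr aff_liebxx aff_lieb_jacobi.

Definition aff_pow_J (p : nat) (x : {ffun 'I_p -> aff R}) :
  {ffun 'I_p -> aff R} := [ffun i => aff_J (x i)].
End Aff.

Section LieTheory.
Variables (R : fieldType) (g : lieAlgType R).
Implicit Types (U V h n : {vspace g}) (x y : g).

Definition ad x : 'End(g) := linfun (lieb x).

Definition lie_prodv U V : {vspace g} :=
  <<[seq lieb u v | u <- vbasis U, v <- vbasis V]>>%VS.

(* lie_prodv U V is the span of all brackets, not only of those of the chosen
   basis vectors. *)
Lemma lie_prodv_subP U V (W : {vspace g}) :
  reflect (forall u v, u \in U -> v \in V -> lieb u v \in W)
          (lie_prodv U V <= W)%VS.
Proof.
apply: (iffP span_subvP) => [sub u v uU vV | sub _ /allpairsP[[u v] /= [uU vV ->]]].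
  rewrite (coord_vbasis uU) (coord_vbasis vV) linear_sumlz rpred_sum // => i _.
  rewrite linearZl_LR rpredZ // linear_sumr rpred_sum // => j _.
  rewrite linearZr rpredZ //; apply: sub; apply/allpairsP.
  by exists ((vbasis U)`_i, (vbasis V)`_j); rewrite !mem_nth ?size_tuple.
by apply: sub; apply: vbasis_mem.
Qed.

Definition is_lie_subalgebra h :=
  forall x y, x \in h -> y \in h -> lieb x y \in h.

Definition is_lie_ideal n := forall x y, y \in n -> lieb x y \in n.

Fixpoint derived_series (k : nat) : {vspace g} :=
  if k is k'.+1 then lie_prodv (derived_series k') (derived_series k')
  else fullv.

Definition lie_solvable := exists k, derived_series k = 0%VS.

Definition two_step_solvable :=
  let g' := lie_prodv fullv fullv in lie_prodv g' g' = 0%VS.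

(* Lower central series of n viewed as a Lie algebra in its own right. *)
Fixpoint lower_central_series n (k : nat) : {vspace g} :=
  if k is k'.+1 then lie_prodv n (lower_central_series n k') else n.

Definition lie_nilpotent n := exists k, lower_central_series n k = 0%VS.

Definition lfun_mx (f : 'End(g)) : 'M[R]_(\dim {:g}) :=
  passmx.mxof (vbasis {:g}) (vbasis {:g}) f.

Definition unimodular := forall x, \tr (lfun_mx (ad x)) = 0.

Definition is_complex_structure (J : 'End(g)) :=
  (forall x, J (J x) = - x) /\
  (forall x y, lieb x y + J (lieb (J x) y) + J (lieb x (J y))
               - lieb (J x) (J y) = 0).

Definition J_invariant (J : 'End(g)) U := (J @: U <= U)%VS.

Definition J_nilpotent_ideal (J : 'End(g)) n :=
  [/\ is_lie_ideal n, lie_nilpotent n & J_invariant J n].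

(* "Maximal" is read as "greatest with respect to inclusion". *)
Definition is_max_J_nilpotent_ideal (J : 'End(g)) n :=
  J_nilpotent_ideal J n /\ (forall m, J_nilpotent_ideal J m -> (m <= n)%VS).

Definition is_aff_pow_subalgebra (J : 'End(g)) (p : nat) h :=
  [/\ is_lie_subalgebra h, J_invariant J h &
    exists f : 'Hom({ffun 'I_p -> aff R}, g),
      [/\ lker f = 0%VS, limg f = h,
          forall x y : {ffun 'I_p -> aff R},
            f (lieb x y) = lieb (f x) (f y) &
          forall x : {ffun 'I_p -> aff R}, f (aff_pow_J x) = J (f x)]].

Definition is_aff_pow_semidirect (J : 'End(g)) (p : nat) n :=
  exists h, [/\ is_aff_pow_subalgebra J p h, (h + n)%VS = fullv
              & (h :&: n)%VS = 0%VS].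

Section Cochains.
Definition cochain (k : nat) := ('I_k -> g) -> R.

Definition fcons m x (Y : 'I_m -> g) : 'I_m.+1 -> g :=
  fun k => oapp Y x (unlift ord0 k).

(* Chevalley-Eilenberg differential in positive degree: the sum over i < j of
   (-1)^(i + j) a([X_i, X_j], X_0, .., omit X_i, .., omit X_j, ..).
   Here lift j i has value i because i < j, so X \o lift j \o lift i omits
   precisely the entries i and j. *)
Definition ce_diff m (a : cochain m.+1) : cochain m.+2 := fun X =>
  \sum_(j < m.+2) \sum_(i < m.+1 | (i < j)%N)
    (-1) ^+ (i + j) *
    a (fcons (lieb (X (lift j i)) (X j)) (X \o lift j \o lift i)).

Definition pullback (f : 'End(g)) k (a : cochain k) : cochain k :=
  fun X => a (f \o X).

(* d^c = J^-1 d J, with (J a)(X_1, .., X_k) = a (J X_1, .., J X_k); since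
   J^2 = - Id, the opposite convention a (J^-1 X_1, .., J^-1 X_k) changes d^c
   only by a sign. *)
Definition dc (J : 'End(g)) m (a : cochain m.+1) : cochain m.+2 :=
  pullback (J^-1)%VF (ce_diff (pullback J a)).
End Cochains.
End LieTheory.

Definition completely_solvable (R : realType) (g : lieAlgType R) :=
  lie_solvable g /\
  forall (x : g) (a : R[i]),
    eigenvalue (map_mx (real_complex R) (lfun_mx (ad x))) a -> a \is Num.real.

Section SKT.
Variables (R : realType) (g : lieAlgType R) (J : 'End(g)).

Definition fundamental_form (q : {dot g for idfun}) : cochain g 2 :=
  fun X => q (J (X ord0)) (X ord_max).

(* {dot g for idfun} is the type of symmetric positive definite forms. *)
Definition is_SKT_metric (q : {dot g for idfun}) :=
  (forall x y, q (J x) (J y) = q x y) /\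
  (forall X, ce_diff (dc J (fundamental_form q)) X = 0).

Definition admits_SKT_metric := exists q : {dot g for idfun}, is_SKT_metric q.
End SKT.

(* Main.v *)
(* Write V = [g, g], which is abelian, so that the operators ad y on V commute and
   have real spectrum, and VJ = V /\ JV. Closedness of the torsion 3-form
   c(a, b, c) = q([Ja, Jb], c) + cyclic is only evaluated on quadruples (x, Jx, y, Jy).
   For a common eigenvector v of V, with weight w, there are two cases.
   If w(Jv) <> 0, then v rescales to x with [Jx, x] = x, and (x, Jx) spans a copy of
   aff(R); distinct such x are mutually orthogonal in the sense that [Jx, x'] = 0, so
   that there are finitely many of them, spanning aff(R)^p.
   If w(Jv) = 0, the quadruple (v, Jv, y, Jy) gives
     w(y)^2 + w(Jy)^2 <= w(J[y, Jy])  for all y, and  w(J[Jy, y]) = -2 w(Jy)^2  on V.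
   Let n be the set of y such that both y and Jy commute with all these x. It is an
   ideal, the second relation makes w vanish on J(V /\ n), and then the first makes w
   vanish on n. Hence all weights vanish on n, i.e. n is nilpotent; it contains every
   J-invariant nilpotent ideal, since an element of such an ideal acts on x by 0. *)
From HB Require Import structures.
Require Import Defs.
From mathcomp Require Import all_boot all_order all_algebra.
From mathcomp Require Import reals boolp sesquilinear complex ring lra.

Set Implicit Arguments.
Unset Strict Implicit.
Unset Printing Implicit Defensive.

Import Order.TTheory GRing.Theory Num.Theory.
Import passmx.
Local Open Scope ring_scope.

HB.instance Definition _ (R : fieldType) (g : lieAlgType R) (x : g) :=
  GRing.isLinear.Build R g g *:%R (lieb x) (lieb_linearr x).

Section LieBracket.
Variables (R : fieldType) (g : lieAlgType R).
Implicit Types x y z : g.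

Lemma liebDl x y z : lieb (x + y) z = lieb x z + lieb y z.
Proof. exact: linearDl. Qed.
Lemma liebDr x y z : lieb x (y + z) = lieb x y + lieb x z.
Proof. exact: linearDr. Qed.
Lemma liebNl x y : lieb (- x) y = - lieb x y.
Proof. exact: linearNl. Qed.
Lemma liebNr x y : lieb x (- y) = - lieb x y.
Proof. exact: linearNr. Qed.
Lemma liebZl a x y : lieb (a *: x) y = a *: lieb x y.
Proof. exact: linearZl_LR. Qed.
Lemma liebZr a x y : lieb x (a *: y) = a *: lieb x y.
Proof. exact: linearZr. Qed.
Lemma lieb0l x : lieb 0 x = 0.
Proof. exact: linear0l. Qed.
Definition liebE := (liebDl, liebDr, liebNl, liebNr, liebZl, liebZr).

Lemma liebC x y : lieb x y = - lieb y x.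
Proof.
apply/eqP; rewrite -addr_eq0; apply/eqP.
by have := liebxx (x + y); rewrite !liebE !liebxx add0r addr0.
Qed.

Lemma lieb_leibniz x y z :
  lieb x (lieb y z) = lieb (lieb x y) z + lieb y (lieb x z).
Proof.
apply/eqP; rewrite -subr_eq0 -(lieb_jacobi x y z) [lieb z x]liebC.
by rewrite [lieb z (lieb x y)]liebC liebNr opprD addrA addrAC.
Qed.

Lemma adE x y : ad x y = lieb x y.
Proof. exact: lfunE. Qed.

Lemma lieb_lie_prodv (U W : {vspace g}) x y :
  x \in U -> y \in W -> lieb x y \in lie_prodv U W.
Proof. by move=> xU yW; move/lie_prodv_subP: (subvv (lie_prodv U W)); apply. Qed.

End LieBracket.

(** * Real spectrum and common eigenvectors *)

Section RealSpectrum.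

(** The characteristic polynomial splits over [R[i]] with real roots, hence over [R];
    Cayley-Hamilton kills the product of its factors. *)
Lemma real_spectrum_split (R : rcfType) n (M : 'M[R]_n) :
    (forall a : R[i], eigenvalue (map_mx (real_complex R) M) a ->
       a \is Num.real) ->
  exists s : seq R, forall u : 'rV_n,
    foldr (fun c (w : 'rV_n) => w *m M - c *: w) u s = 0.
Proof.
case: n M => [|n] M hM; first by exists [::] => u; apply: thinmx0.
pose p := char_poly (map_mx (real_complex R) M).
have [r pE] := closed_field_poly_normal p.
have /monicP lp : p \is monic by apply: char_poly_monic.
rewrite lp scale1r in pE.
pose s := [seq complex.Re z | z <- r].
have pE' : char_poly M = \prod_(c <- s) ('X - c%:P).
  apply: (@map_poly_inj _ _ (real_complex R)).
  rewrite map_char_poly -/p pE rmorph_prod big_map /=.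
  apply: eq_big_seq => z zr; rewrite rmorphB /= map_polyX map_polyC /=.
  congr (_ - _%:P).
  have /hM : eigenvalue (map_mx (real_complex R) M) z.
    by rewrite eigenvalue_root_char -/p pE root_prod_XsubC.
  by move/RRe_real.
have CH := Cayley_Hamilton M.
exists s => u.
have -> : foldr (fun c (w : 'rV_n.+1) => w *m M - c *: w) u s
   = u *m horner_mx M (\prod_(c <- rev s) ('X - c%:P)).
  elim: (s) => [|c s' IH] /=; first by rewrite big_nil rmorph1 mulmx1.
  rewrite IH rev_cons -cats1 big_cat big_seq1 /= rmorphM rmorphB /=.
  by rewrite horner_mx_X horner_mx_C mulmxA mulmxBr mul_mx_scalar.
rewrite (perm_big s) /=; last by rewrite perm_rev.
by rewrite -pE' CH mulmx0.
Qed.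

End RealSpectrum.

Section Eigenvectors.
Variables (R : fieldType) (g : lieAlgType R).
Implicit Types (x y u v w : g) (U W : {vspace g}) (c : R) (s : seq R).

(** A product of linear factors over [R] annihilates [ad x]; [s] may contain more than its
    eigenvalues. *)
Definition ad_roots x s :=
  forall w, foldr (fun c w' => lieb x w' - c *: w') w s = 0.

Lemma ad_roots_eigenvalue x s w c :
  ad_roots x s -> w != 0 -> lieb x w = c *: w -> c \in s.
Proof.
move=> hs w0 xw; have: foldr (fun c w' => lieb x w' - c *: w') w s
    = (\prod_(a <- s) (c - a)) *: w.
  elim: (s) => [|a s' IH] /=; first by rewrite big_nil scale1r.
  by rewrite IH big_cons liebZr xw !scalerA -scalerBl [a * _]mulrC -mulrBr mulrC.
rewrite hs => /esym/eqP; rewrite scaler_eq0 (negPf w0) orbF prodf_seq_eq0.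
by case/hasP => a sa /=; rewrite subr_eq0 => /eqP->.
Qed.

(** Apply the factors one after the other to a nonzero vector of [W]: the last nonzero value is an
    eigenvector, still in [W]. *)
Lemma ad_roots_eigenvector x s W : ad_roots x s ->
    (forall w, w \in W -> lieb x w \in W) -> W != 0%VS ->
  exists w c, [/\ w \in W, w != 0 & lieb x w = c *: w].
Proof.
move=> hs xW W0; have [w wW w0] : exists2 w, w \in W & w != 0.
  by exists (vpick W); [exact: memv_pick | rewrite vpick0].
have: foldr (fun c w' => lieb x w' - c *: w') w s = 0 by exact: hs.
elim: (s) => [|c s' IH] /= => [/eqP|]; first by rewrite (negPf w0).
set w' := foldr _ _ _; have [/IH // | w'0 /eqP] := eqVneq w' 0.
rewrite subr_eq0 => /eqP xw'; exists w', c; split=> //.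
rewrite /w'; elim: (s') => //= a s'' IH'.
by rewrite rpredB ?rpredZ ?xW.
Qed.

Lemma memv_ker_ad x c w : (w \in lker (ad x - c *: \1)%VF) = (lieb x w == c *: w).
Proof. by rewrite memv_ker !lfunE /= opp_lfunE scale_lfunE id_lfunE adE subr_eq0. Qed.

Hypothesis real_spec : forall x, exists s, ad_roots x s.

(** Induction on the dimension: if some [u] is not scalar on [W], it has an eigenspace in [W] that
    is nonzero, proper, and stable by commutation. *)
Lemma common_ad_eigenvector U W :
    (forall u u' w, u \in U -> u' \in U -> w \in W ->
       lieb u (lieb u' w) = lieb u' (lieb u w)) ->
    (forall u w, u \in U -> w \in W -> lieb u w \in W) -> W != 0%VS ->
  exists w, [/\ w \in W, w != 0 &
    forall u, u \in U -> exists c, lieb u w = c *: w].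
Proof.
have [n leWn] := ubnP (\dim W); elim: n => // n IH in W leWn *.
move=> comUW invUW W0.
have [|/existsNP [u /not_implyP[uU]]] := pselect (forall u, u \in U ->
    exists c, (W <= lker (ad u - c *: \1)%VF)%VS).
  move=> scal; exists (vpick W); rewrite memv_pick vpick0 W0; split=> // u.
  move/scal => [c sub]; exists c; apply/eqP; rewrite -memv_ker_ad.
  by apply: (subvP sub); exact: memv_pick.
move=> nscal; have [s hs] := real_spec u.
have [w [c [wW w0 uw]]] := ad_roots_eigenvector hs (fun w => invUW u w uU) W0.
pose W' := (W :&: lker (ad u - c *: \1)%VF)%VS.
have inW' v : (v \in W') = (v \in W) && (lieb u v == c *: v).
  by rewrite memv_cap memv_ker_ad.
have [] := IH W'.
- rewrite -ltnS; apply: leq_trans leWn; rewrite ltnS.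
  rewrite ltn_neqAle dimvS ?capvSl // andbT; apply/eqP => dimE.
  apply: nscal; exists c; apply/subvP => v.
  have/eqP <- : W' == W by rewrite eqEdim capvSl dimE leqnn.
  by rewrite memv_cap => /andP[].
- by move=> u1 u2 v h1 h2; rewrite inW' => /andP[vW _]; apply: comUW.
- move=> u1 v h1; rewrite !inW' => /andP[vW /eqP uv].
  by rewrite invUW // comUW // uv liebZr eqxx.
- apply/eqP => W'0; have : w \in W' by rewrite inW' wW uw eqxx.
  by rewrite W'0 memv0 (negPf w0).
move=> v []; rewrite inW' => /andP[vW _] v0 hv.
by exists v.
Qed.

End Eigenvectors.

Lemma completely_solvable_roots (R : realType) (g : lieAlgType R) :
  completely_solvable g -> forall x : g, exists s, ad_roots x s.
Proof.
case=> _ hg x.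
have [s hs] := real_spectrum_split (hg x); exists s => w.
pose e := vbasis {:g}.
have he : basis_of {:g} e by apply: vbasisP.
apply/eqP; rewrite -(rVof_eq0 he); apply/eqP.
rewrite -[RHS](hs (rVof e w)).
elim: (s) => //= c s' <-.
by rewrite linearB linearZ /= -adE (rVof_app _ he).
Qed.

(** * The SKT condition as closedness of the torsion form *)

Section SKTIdentity.
Variables (R : realType) (g : lieAlgType R) (J : 'End(g)).
Variable q : {dot g for idfun}.
Hypothesis JJ : forall x, J (J x) = - x.
Hypothesis qJJ : forall x y, q (J x) (J y) = q x y.

(** This is [dc] of the fundamental form, see [dc_fundamental_formE]. *)
Definition torsion (a b c : g) : R :=
  q (lieb (J a) (J b)) c + q (lieb (J b) (J c)) a + q (lieb (J c) (J a)) b.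

Lemma fcons0 m x (Y : 'I_m -> g) : fcons x Y ord0 = x.
Proof. by rewrite /fcons unlift_none. Qed.

Lemma fcons_lift m x (Y : 'I_m -> g) i : fcons x Y (lift ord0 i) = Y i.
Proof. by rewrite /fcons liftK. Qed.

Lemma invJ x : (J^-1)%VF x = - J x.
Proof.
have kJ : lker J == 0%VS.
  apply/lker0P => a b eab; apply: oppr_inj.
  by rewrite -!JJ eab.
by rewrite -[in LHS](opprK x) -(JJ (- x)) lker0_lfunK // linearN.
Qed.

Lemma lift_lift0 m (i : 'I_m.+1) : lift (lift ord0 i) ord0 = ord0 :> 'I_m.+2.
Proof. exact: val_inj. Qed.

Lemma lift_lift m (i : 'I_m.+1) (j : 'I_m) :
  lift (lift ord0 i) (lift ord0 j) = lift ord0 (lift i j).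
Proof. by apply: val_inj; rewrite /= bumpS. Qed.

Lemma ce_diff2E (a : cochain g 2) (phi : g -> g -> R) (X : 'I_3 -> g) :
  (forall Y, a Y = phi (Y ord0) (Y (lift ord0 ord0))) ->
  let x := X ord0 in let y := X (lift ord0 ord0) in
  let z := X (lift ord0 (lift ord0 ord0)) in
  ce_diff a X = - phi (lieb x y) z + phi (lieb x z) y - phi (lieb y z) x.
Proof.
move=> ha x y z; rewrite /ce_diff.
under eq_bigr => j _ do
  rewrite big_mkcond !big_ord_recl big_ord0 !ha !fcons0 !fcons_lift /=.
rewrite !big_ord_recl big_ord0 /=.
rewrite !(lift_lift, lift_lift0) /bump /=.
rewrite -/x -/y -/z. ring.
Qed.

Lemma ce_diff3E (a : cochain g 3) (phi : g -> g -> g -> R) (x y z t : g) :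
  (forall Y, a Y = phi (Y ord0) (Y (lift ord0 ord0))
                       (Y (lift ord0 (lift ord0 ord0)))) ->
  ce_diff a (fun i : 'I_4 => nth 0 [:: x; y; z; t] i) =
  - phi (lieb x y) z t + phi (lieb x z) y t - phi (lieb x t) y z
  - phi (lieb y z) x t + phi (lieb y t) x z - phi (lieb z t) x y.
Proof.
move=> ha; rewrite /ce_diff.
under eq_bigr => j _ do
  rewrite big_mkcond !big_ord_recl big_ord0 !ha !fcons0 !fcons_lift.
rewrite !big_ord_recl big_ord0.
rewrite /= /bump /=.
ring.
Qed.

(** Invariance of [q] makes the pullback of the fundamental form by [J] the form itself and, with
    [J^-1 = - J], strips the outer [J] from each term. *)
Lemma dc_fundamental_formE (X : 'I_3 -> g) :
  dc J (fundamental_form J q) X =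
  torsion (X ord0) (X (lift ord0 ord0)) (X (lift ord0 (lift ord0 ord0))).
Proof.
rewrite /dc /pullback (@ce_diff2E _ (fun x y => q (J x) y)) /=; last first.
  move=> Y; rewrite /fundamental_form /= qJJ.
  by congr (q (J _) (Y _)); exact: val_inj.
rewrite !invJ !liebE !opprK !linearNr /= !qJJ /torsion.
rewrite [lieb (J _) (J (X ord0))]liebC linearNl /=; ring.
Qed.

Lemma torsion_closed x y z t :
  (forall X, ce_diff (dc J (fundamental_form J q)) X = 0) ->
  - torsion (lieb x y) z t + torsion (lieb x z) y t - torsion (lieb x t) y z
  - torsion (lieb y z) x t + torsion (lieb y t) x z - torsion (lieb z t) x y = 0.
Proof. by move=> dcl; rewrite -(ce_diff3E x y z t dc_fundamental_formE). Qed.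

End SKTIdentity.

(** * Weights of two-step solvable SKT algebras *)

Section TwoStepSKT.
Variables (R : realType) (g : lieAlgType R) (J : 'End(g)).
Variables (V : {vspace g}) (q : {dot g for idfun}).
Implicit Types (a b c e u v w x y z : g).
Hypothesis lieb_V : forall x y, lieb x y \in V.
Hypothesis abelian_V : forall x y, x \in V -> y \in V -> lieb x y = 0.
Hypothesis roots_ad : forall x, exists s, ad_roots x s.
Hypothesis JJ : forall x, J (J x) = - x.
Hypothesis integrable : forall x y,
  lieb x y + J (lieb (J x) y) + J (lieb x (J y)) - lieb (J x) (J y) = 0.
Hypothesis qJJ : forall x y, q (J x) (J y) = q x y.
Hypothesis dtorsion0 : forall x y z t,
  - torsion J q (lieb x y) z t + torsion J q (lieb x z) y t
  - torsion J q (lieb x t) y z - torsion J q (lieb y z) x t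
  + torsion J q (lieb y t) x z - torsion J q (lieb z t) x y = 0.

Lemma JD x y : J (x + y) = J x + J y. Proof. exact: linearD. Qed.
Lemma JN x : J (- x) = - J x. Proof. exact: linearN. Qed.
Lemma JZ k x : J (k *: x) = k *: J x. Proof. exact: linearZ. Qed.
Lemma qDl x y z : q (x + y) z = q x z + q y z. Proof. exact: linearDl. Qed.
Lemma qDr x y z : q x (y + z) = q x y + q x z. Proof. exact: linearDr. Qed.
Lemma qNl x y : q (- x) y = - q x y. Proof. exact: linearNl. Qed.
Lemma qNr x y : q x (- y) = - q x y. Proof. exact: linearNr. Qed.
Lemma qZl k x y : q (k *: x) y = k * q x y. Proof. exact: linearZl_LR. Qed.
Lemma qZr k x y : q x (k *: y) = k * q x y. Proof. exact: linearZr. Qed.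
Lemma q0l x : q 0 x = 0. Proof. exact: linear0l. Qed.
Lemma q0r x : q x 0 = 0. Proof. exact: linear0r. Qed.
Lemma qC x y : q x y = q y x. Proof. by rewrite hermC expr0 mul1r. Qed.
Lemma q_gt0 x : x != 0 -> 0 < q x x. Proof. exact: neq0_dnorm_gt0. Qed.
Lemma q_ge0 x : 0 <= q x x.
Proof. by have [->|/q_gt0/ltW//] := eqVneq x 0; rewrite q0l. Qed.
Lemma q_eq0 x : q x x <= 0 -> x = 0.
Proof. by move=> qx; apply/eqP/negPn/negP => /q_gt0; rewrite ltNge qx. Qed.
Lemma qJl x y : q (J x) y = - q x (J y).
Proof. by rewrite -[y in LHS]opprK -(JJ y) qNr qJJ. Qed.
Definition qE := (qDl, qDr, qNl, qNr, qZl, qZr, q0l, q0r).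
Definition JE := (JD, JN, JZ).

Lemma torsionNl x y z : torsion J q (- x) y z = - torsion J q x y z.
Proof. by rewrite /torsion !(JN, liebE, qE) /= !opprD. Qed.
Lemma torsionZl k x y z : torsion J q (k *: x) y z = k * torsion J q x y z.
Proof. by rewrite /torsion !(JZ, liebE, qE) /= !mulrDr. Qed.
Lemma torsion0l y z : torsion J q 0 y z = 0.
Proof. by rewrite -(scale0r 0) torsionZl mul0r. Qed.
Lemma torsionDl a x y z :
  torsion J q (a + x) y z = torsion J q a y z + torsion J q x y z.
Proof. rewrite /torsion !(JD, liebE, qE) /=; ring. Qed.

(** * Brackets on [V] and on its [J]-invariant part *)

Lemma lieb_comm x y w : w \in V -> lieb x (lieb y w) = lieb y (lieb x w).
Proof. by move=> wV; rewrite lieb_leibniz [lieb (lieb x y) w]abelian_V ?add0r. Qed.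

(** The largest [J]-invariant subspace of [V]. *)
Definition VJ : {vspace g} := (V :&: J @^-1: V)%VS.
Lemma mem_VJ x : (x \in VJ) = (x \in V) && (J x \in V).
Proof. by rewrite memv_cap memv_preim. Qed.
Lemma VJ_V x : x \in VJ -> x \in V. Proof. by rewrite mem_VJ => /andP[]. Qed.
Lemma VJ_JV x : x \in VJ -> J x \in V. Proof. by rewrite mem_VJ => /andP[]. Qed.
Lemma VJ_J x : x \in VJ -> J x \in VJ.
Proof. by rewrite !mem_VJ JJ memvN andbC. Qed.

Lemma lieb_JJ x y : lieb (J x) (J y) =
  lieb x y + J (lieb (J x) y) + J (lieb x (J y)).
Proof. by apply/esym/eqP; rewrite -subr_eq0 integrable. Qed.

Lemma lieb_JJ_V x y : x \in V -> y \in V ->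
  lieb (J x) (J y) = J (lieb (J x) y - lieb (J y) x).
Proof.
by move=> xV yV; rewrite lieb_JJ abelian_V // add0r !JE [lieb x _]liebC JN.
Qed.

(** By [lieb_JJ_V], [J] maps this difference to a bracket. Thus [(x, y) |-> lieb (J x) y] is
    commutative on [V] modulo [VJ]. *)
Lemma commutator_VJ x y : x \in V -> y \in V ->
  lieb (J x) y - lieb (J y) x \in VJ.
Proof. by move=> xV yV; rewrite mem_VJ -lieb_JJ_V // !lieb_V rpredB. Qed.

Lemma lieb_J_VJ x y : x \in VJ -> y \in V -> lieb (J y) (J x) = J (lieb (J y) x).
Proof.
move=> xVJ yV; rewrite lieb_JJ_V ?(VJ_V xVJ) //.
by rewrite [lieb (J x) y]abelian_V ?(VJ_JV xVJ) ?subr0.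
Qed.

Lemma lieb_VJ x y : x \in VJ -> y \in V -> lieb (J y) x \in VJ.
Proof. by move=> xV yV; rewrite mem_VJ -lieb_J_VJ // !lieb_V. Qed.

(** Closedness of the torsion on [(x, J x, y, J y)]: only the brackets with [J y] survive, and those
    of [x] and [J x] contribute equally. *)
Lemma skt_VJ x y : x \in VJ -> y \in V ->
  let B := lieb (J y) in
  q (B x) (B x) + q (B (B x)) x + q (lieb (J (B y)) x) x = 0.
Proof.
move=> xVJ yV B.
have [xV JxV] := (VJ_V xVJ, VJ_JV xVJ).
have wVJ : B x \in VJ by exact: lieb_VJ.
have [wV JwV] := (VJ_V wVJ, VJ_JV wVJ).
have := dtorsion0 x (J x) y (J y).
rewrite [lieb x (J x)]abelian_V // [lieb x y]abelian_V // [lieb (J x) y]abelian_V //.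
rewrite [lieb x (J y)]liebC [lieb (J x) (J y)]liebC [lieb y (J y)]liebC.
rewrite (lieb_J_VJ xVJ) // -/(B x) -/(B y) !torsionNl !torsion0l.
have -> : torsion J q (B x) (J x) y = q (B x) (B x) + q (B (B x)) x.
  rewrite /torsion JJ !liebNl !liebNr [lieb _ x]abelian_V // [lieb x _]liebC.
  by rewrite (lieb_J_VJ wVJ) // qJJ !qE opprK oppr0 add0r.
have -> : torsion J q (J (B x)) x y = - (q (B x) (B x) + q (B (B x)) x).
  rewrite /torsion JJ !liebNl !liebNr [lieb _ (J x)]abelian_V //.
  by rewrite [lieb (J x) (J y)]liebC (lieb_J_VJ xVJ) // -!/(B _) !qE qJJ oppr0
    add0r -opprD.
have -> : torsion J q (B y) x (J x) = 2 * q (lieb (J (B y)) x) x.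
  rewrite /torsion JJ !liebNl !liebNr [lieb (J x) x]abelian_V // [lieb x _]liebC.
  by rewrite (lieb_J_VJ xVJ) ?lieb_V // qJJ !qE; ring.
lra.
Qed.

(** A Rayleigh quotient: linear in [y] for every [v], and the eigenvalue of [ad y] when [v] is an
    eigenvector. *)
Definition wt v y : R := q (lieb y v) v / q v v.

Definition eigv v := [/\ v \in V, v != 0 & forall y, lieb y v = wt v y *: v].

Lemma wtE v y k : v != 0 -> lieb y v = k *: v -> wt v y = k.
Proof. by move=> v0 e; rewrite /wt e qZl mulfK // gt_eqF ?q_gt0. Qed.
Lemma wtD v x y : wt v (x + y) = wt v x + wt v y.
Proof. by rewrite /wt liebDl qDl mulrDl. Qed.
Lemma wt0 v : wt v 0 = 0.
Proof. by rewrite /wt lieb0l q0l mul0r. Qed.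
Lemma wtN v x : wt v (- x) = - wt v x.
Proof. by rewrite /wt liebNl qNl mulNr. Qed.
Lemma wtZ v k x : wt v (k *: x) = k * wt v x.
Proof. by rewrite /wt liebZl qZl mulrA. Qed.
Lemma wt_V v y : v \in V -> y \in V -> wt v y = 0.
Proof. by move=> vV yV; rewrite /wt abelian_V // q0l mul0r. Qed.

Lemma qJ_self x : q x (J x) = 0.
Proof. by have := qJl x x; rewrite qC => h; lra. Qed.

(** * Weights with [wt v (J v) = 0] *)

Section Weight.
Variable v : g.
Hypothesis hv : eigv v.
Hypothesis wtJv : wt v (J v) = 0.

Let vV : v \in V. Proof. by case: hv. Qed.
Let v0 : v != 0. Proof. by case: hv. Qed.
Let hwt y : lieb y v = wt v y *: v. Proof. by case: hv. Qed.

(* If [M = ad (J v)] has [M (M u) = 0] on [VJ], then [skt_VJ] forces [M u = 0];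
   and a real eigenvalue [mu] of [M] on [VJ] satisfies [2 mu ^ 2 = 0]. *)
Lemma lieb_Jv_VJ x : x \in VJ -> lieb (J v) x = 0.
Proof.
pose M := lieb (J v).
have skt u : u \in VJ -> q (M u) (M u) + q (M (M u)) u = 0.
  move=> uVJ; have := skt_VJ uVJ vV.
  by rewrite /= hwt wtJv scale0r linear0 lieb0l q0l addr0.
have ker2 u : u \in VJ -> M (M u) = 0 -> M u = 0.
  by move=> uVJ MMu; apply: q_eq0; have := skt u uVJ; rewrite MMu q0l addr0 => ->.
pose T := (ad (J v) @: VJ)%VS.
have inT u : u \in T -> exists2 x, x \in VJ & u = M x.
  by move=> /memv_imgP[y yVJ ->]; exists y => //; rewrite adE.
have TM y : y \in VJ -> M y \in T by move=> yVJ; rewrite -[M y]adE memv_img.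
have TVJ u : u \in T -> u \in VJ by move=> /inT[y yVJ ->]; apply: lieb_VJ.
have [T0|TN0] := eqVneq T 0%VS.
  by move=> xVJ; apply/eqP; rewrite -memv0 -T0; apply: TM.
have [s hs] := roots_ad (J v).
have [u [k [/[dup] uT /inT[y yVJ uE] u0 Mu]]] :=
  ad_roots_eigenvector hs (fun u uT => TM u (TVJ u uT)) TN0.
rewrite -/(M u) in Mu.
have := skt u (TVJ u uT); rewrite Mu /M liebZr -/(M u) Mu !qE.
move/eqP; rewrite !mulrA -mulrDl mulf_eq0 orbC gt_eqF ?q_gt0 //= -mulr2n.
rewrite mulrn_eq0 mulf_eq0 orbb /= => /eqP k0.
by move: u0; rewrite uE ker2 ?eqxx // -/(M y) -uE Mu k0 scale0r.
Qed.

(** Integrability at [(y, v)] gives the second formula, and by it [J e] lies in [V], as [e] does. *)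
Lemma lieb_J_eigv y :
  let e := lieb y (J v) + wt v (J y) *: v in
  e \in VJ /\ lieb (J y) (J v) = wt v y *: v + J e.
Proof.
move=> e; have JeE : lieb (J y) (J v) = wt v y *: v + J e.
  rewrite lieb_JJ !hwt -addrA -JD /e addrC [in LHS]addrC.
  by congr (_ + J _); rewrite addrC.
split=> //; rewrite mem_VJ rpredD ?lieb_V ?rpredZ //=.
have -> : J e = lieb (J y) (J v) - wt v y *: v by rewrite JeE addrC addKr.
by rewrite rpredB ?lieb_V ?rpredZ.
Qed.

(** Closedness on [(v, J v, y, J y)]; [lieb_Jv_VJ] removes the brackets of [J v] with [e] and
    [J e]. *)
Lemma skt_eigv y :
  let z := lieb y (J y) in
  let e := lieb y (J v) + wt v (J y) *: v in
  (wt v y ^+ 2 + wt v (J y) ^+ 2) * q v v + q e e + q (lieb (J v) z) v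
  = wt v (J z) * q v v.
Proof.
move=> z e; have [eVJ FE] := lieb_J_eigv y; rewrite -/e in eVJ FE.
set p := wt v y in FE *; set r := wt v (J y) in e eVJ FE *.
have EE : lieb y (J v) = e - r *: v by rewrite addrK.
clearbody e.
have vJv : lieb v (J v) = 0 by rewrite liebC hwt wtJv scale0r oppr0.
have [eV JeV] := (VJ_V eVJ, VJ_JV eVJ).
(* The Jacobi identity for [y], [J y], [J v], paired with [v], serves to remove the two mixed
   terms. *)
have jac : q (lieb y (J e)) v - q (lieb (J y) e) v
    = - (p ^+ 2 + r ^+ 2) * q v v - q (lieb (J v) z) v.
  have := congr1 (q^~ v) (lieb_leibniz y (J y) (J v)); rewrite /= FE EE -/z !liebE.
  by rewrite !hwt -/p -/r [lieb z _]liebC !qE => h; lra.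
have := dtorsion0 v (J v) y (J y).
rewrite vJv torsion0l [lieb v y]liebC [lieb v (J y)]liebC.
rewrite [lieb (J v) y]liebC [lieb (J v) (J y)]liebC FE EE !hwt -/p -/r -/z.
rewrite !torsionNl !(torsionDl, torsionNl, torsionZl).
have -> : torsion J q v (J v) (J y) = - p * q v v - q e (J v).
  rewrite /torsion !JJ !liebE !opprK [lieb (J v) v]liebC vJv EE [lieb v y]liebC hwt -/p.
  by rewrite !qE qJ_self; ring.
have -> : torsion J q v (J v) y = r * q v v + q e v.
  rewrite /torsion !JJ !liebE [lieb (J v) v]liebC vJv FE [lieb v (J y)]liebC hwt -/r.
  by rewrite !qE qJJ qJ_self; ring.
have tvv w : torsion J q v v w = 0.
  by rewrite /torsion liebxx [lieb (J w) _]liebC !qE; ring.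
have -> : torsion J q e v (J y) = q e e - r * q v e - q (lieb y (J e)) v.
  rewrite /torsion !JJ !liebE [lieb (J e) _]liebC lieb_Jv_VJ ?VJ_J //.
  by rewrite [lieb (J v) y]liebC EE !qE; ring.
have -> : torsion J q (J e) v y = - p * q v (J e) - q e e - q (lieb (J y) e) v.
  rewrite /torsion !JJ !liebE [lieb e _]liebC lieb_Jv_VJ //.
  by rewrite [lieb (J v) (J y)]liebC FE !qE qJJ; ring.
have -> : torsion J q z v (J v) = 2 * wt v (J z) * q v v - q (lieb (J v) z) v.
  rewrite /torsion !JJ !liebE lieb_JJ_V ?lieb_V // hwt.
  rewrite [lieb (J v) v]liebC vJv [lieb v (J z)]liebC hwt qJJ !qE; ring.
rewrite !tvv.
move: jac; have := qC e v; have := qJl e v; rewrite [q (J e) v]qC.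
move: (q (lieb y (J e)) v) (q (lieb (J y) e) v) => A B.
by move=> -> ->; lra.
Qed.

(* [V / VJ] is a commutative associative algebra for [(y, z) |-> lieb (J y) z]. If
   [v] is not in [VJ], then [f] is a character of it and [s] maps it
   equivariantly to [VJ], where [skt_VJ] rules out the eigenvalues that the
   equivariance prescribes; so [s = 0], and [skt_s] gives [f = 0]. *)
Let f y := wt v (J y).
Let s y := lieb (J v) y - f y *: v.

Let f_VJ y : y \in VJ -> f y = 0.
Proof. by move=> yVJ; rewrite /f wt_V // VJ_JV. Qed.

Let sD x y : s (x + y) = s x + s y.
Proof. by rewrite /s /f liebDr JD wtD scalerDl opprD addrACA. Qed.

Let sN x : s (- x) = - s x.
Proof. by rewrite /s /f liebNr JN wtN scaleNr opprD. Qed.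

Let s_VJ y : y \in VJ -> s y = 0.
Proof. by move=> yVJ; rewrite /s lieb_Jv_VJ // f_VJ // scale0r subr0. Qed.

Let s_congr x y : x - y \in VJ -> s x = s y.
Proof. by move/s_VJ/eqP; rewrite sD sN subr_eq0 => /eqP. Qed.

Let s_in_VJ y : y \in V -> s y \in VJ.
Proof. by move=> yV; rewrite /s /f -hwt commutator_VJ. Qed.

Let skt_s y : y \in V ->
  f y ^+ 2 * q v v + q (s y) (s y) = q (s (lieb (J y) y)) v.
Proof.
move=> yV; have := skt_eigv y; rewrite /= [lieb y (J v)]liebC.
rewrite [lieb y (J y)]liebC wt_V // JN wtN -/(f _) -/(f _) liebNr.
have -> : - lieb (J v) y + f y *: v = - s y by rewrite /s opprB addrC.
rewrite /(s (lieb _ _)) !qE => h; lra.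
Qed.

Lemma wt_notin_VJ y : v \notin VJ -> wt v y = 0.
Proof.
move=> vVJ.
(* The defect of multiplicativity of [f], times [v], lies in [VJ]; as [v] does not, the defect is
   zero. *)
have mult x z : x \in V -> z \in V -> s (lieb (J x) z) = lieb (J x) (s z).
  move=> xV zV; have : (f z * f x - f (lieb (J x) z)) *: v \in VJ.
    have -> : (f z * f x - f (lieb (J x) z)) *: v = s (lieb (J x) z) - lieb (J x) (s z).
      rewrite /s lieb_comm // liebDr liebNr liebZr hwt -/(f x) scalerA scalerBl.
      by rewrite opprB [in RHS]addrC addrA subrK.
    by rewrite rpredB ?s_in_VJ ?lieb_V ?lieb_VJ ?s_in_VJ.
  rewrite rpredZeq (negPf vVJ) orbF subr_eq0 => /eqP fM.
  rewrite /s lieb_comm // liebDr liebNr liebZr hwt -/(f x) scalerA.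
  by rewrite -fM.
(* The image of [V] under [s], as a subspace: since [v] is not in [VJ], intersecting with [VJ]
   forces the multiple of [v]. *)
pose T := ((ad (J v) @: V + <[v]>) :&: VJ)%VS.
have Ts u : reflect (exists2 z, z \in V & u = s z) (u \in T).
  apply: (iffP idP) => [|[z zV ->]]; rewrite memv_cap; last first.
    rewrite s_in_VJ // andbT /s -scaleNr memv_add //; last by rewrite rpredZ ?memv_line.
    by rewrite -adE memv_img.
  case/andP => /memv_addP[a /memv_imgP[z zV ->]] [b /vlineP[k ->]] -> inVJ.
  rewrite adE in inVJ *; exists z => //.
  have : (k + f z) *: v \in VJ.
    have -> : (k + f z) *: v = lieb (J v) z + k *: v - s z.
      by rewrite /s opprB [_ + k *: v]addrC addrACA subrr addr0 scalerDl.
    by rewrite rpredB ?s_in_VJ.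
  rewrite rpredZeq (negPf vVJ) orbF addr_eq0 => /eqP->.
  by rewrite /s scaleNr.
have s0 z : z \in V -> s z = 0.
  have [T0 zV|TN0] := eqVneq T 0%VS.
    by apply/eqP; rewrite -memv0 -T0; apply/Ts; exists z.
  have [||r [/Ts[x xV rE] r0 hr]] :=
    common_ad_eigenvector roots_ad (U := (J @: V)%VS) _ _ TN0.
  - by move=> u u' w _ _ /Ts[t tV ->]; rewrite lieb_comm // VJ_V ?s_in_VJ.
  - move=> _ w /memv_imgP[u uV ->] /Ts[t tV ->]; rewrite -mult //.
    by apply/Ts; exists (lieb (J u) t).
  have rVJ : r \in VJ by rewrite rE s_in_VJ.
  have Jr0 y' : y' \in V -> lieb (J y') r = 0.
    move=> yV; have [c cE] := hr (J y') (memv_img _ yV).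
    (* As [s] kills [VJ], the commutative and associative product modulo [VJ] turns [(y' y') x] into
       [y' (y' x)]. *)
    have sc : lieb (J (lieb (J y') y')) r = c ^+ 2 *: r.
      rewrite rE -mult ?lieb_V // (s_congr (commutator_VJ (lieb_V _ _) xV)).
      rewrite lieb_comm // mult ?lieb_V // (s_congr (commutator_VJ xV yV)).
      by rewrite mult // -rE !cE !liebZr cE scalerA.
    (* All three terms of [skt_VJ] equal [c ^+ 2 * q r r]. *)
    have := skt_VJ rVJ yV; rewrite /= sc cE liebZr cE !qE => h.
    have : 3 * (c ^+ 2 * q r r) = 0 by rewrite -h; ring.
    move/eqP; rewrite mulf_eq0 pnatr_eq0 /= mulf_eq0 expf_eq0 /=.
    rewrite [q r r == 0]gt_eqF ?q_gt0 // orbF.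
    by move/eqP => ->; rewrite scale0r.
  have := skt_s xV; rewrite mult // -rE Jr0 // q0l => h.
  suff r00 : r = 0 by move: r0; rewrite r00 eqxx.
  apply: q_eq0; have : 0 <= f x ^+ 2 * q v v by rewrite mulr_ge0 ?sqr_ge0 ?q_ge0.
  lra.
have f0 z : z \in V -> f z = 0.
  move=> zV; have := skt_s zV; rewrite !s0 ?lieb_V // !q0l addr0 => /eqP.
  by rewrite mulf_eq0 expf_eq0 /= [q v v == 0]gt_eqF ?q_gt0 // orbF => /eqP.
have := skt_eigv y; rewrite /= -/(f (lieb _ _)) f0 ?lieb_V //.
have -> : lieb (J v) (lieb y (J y)) = 0.
  by have := s0 _ (lieb_V y (J y)); rewrite /s f0 ?lieb_V // scale0r subr0.
rewrite q0l mul0r addr0 => h.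
have qv := q_gt0 v0; have qe := q_ge0 (lieb y (J v) + wt v (J y) *: v).
have : wt v y ^+ 2 * q v v <= 0.
  have : 0 <= wt v (J y) ^+ 2 * q v v by rewrite mulr_ge0 ?sqr_ge0 ?q_ge0.
  move: h; rewrite mulrDl; lra.
rewrite pmulr_lle0 // => h'; apply/eqP; rewrite -sqrf_eq0.
by rewrite eq_le h' sqr_ge0.
Qed.

(** For [v] in [VJ], [skt_eigv] has [e = wt v (J y) *: v], whose norm doubles the square; otherwise
    both sides are zero. *)
Lemma wt_J_square y : y \in V -> wt v (J (lieb (J y) y)) = - 2 * wt v (J y) ^+ 2.
Proof.
have [vVJ yV|vVJ _] := boolP (v \in VJ); last by rewrite !wt_notin_VJ // expr0n mulr0.
have := skt_eigv y; rewrite /= [lieb y (J v)]abelian_V ?VJ_JV // add0r.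
rewrite [lieb (J v) _]abelian_V ?VJ_JV // wt_V // [lieb y (J y)]liebC JN wtN !qE => h.
have : (wt v (J (lieb (J y) y)) + 2 * wt v (J y) ^+ 2) * q v v = 0 by move: h; lra.
by move/eqP; rewrite mulf_eq0 [q v v == 0]gt_eqF ?q_gt0 // orbF => /eqP; lra.
Qed.

(** For [v] in [VJ], drop [q e e] from [skt_eigv]. *)
Lemma wt_square_le y : wt v y ^+ 2 + wt v (J y) ^+ 2 <= wt v (J (lieb y (J y))).
Proof.
have [vVJ|vVJ] := boolP (v \in VJ); last by rewrite !wt_notin_VJ // expr0n addr0.
have := skt_eigv y; rewrite /= [lieb (J v) _]abelian_V ?VJ_JV // q0l addr0.
by move=> h; rewrite -(ler_pM2r (q_gt0 v0)) -h lerDl q_ge0.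
Qed.
End Weight.
(** * The aff(R) factors and the nilpotent core *)

(** The normalisation leaves at most one such vector on each line, so that all of them can form a
    finite family. *)
Definition aff_elt x := eigv x /\ wt x (J x) = 1.

Lemma wt_scale k v : k != 0 -> wt (k *: v) =1 wt v.
Proof.
move=> k0 y; rewrite /wt liebZr !qE !mulrA -mulf_div.
by rewrite divff ?mul1r // mulf_neq0.
Qed.

Lemma eigvZ k v : k != 0 -> eigv v -> eigv (k *: v).
Proof.
move=> k0 [vV v0 hv]; split=> [||y]; rewrite ?rpredZ ?scaler_eq0 ?negb_or ?k0 //.
by rewrite wt_scale // liebZr hv !scalerA mulrC.
Qed.

Lemma eigv_aff_elt v : eigv v -> wt v (J v) != 0 ->
  exists2 x, aff_elt x & wt x =1 wt v.
Proof.
move=> hv wv; exists ((wt v (J v))^-1 *: v); last by apply: wt_scale; rewrite invr_eq0.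
split; first by apply: eigvZ; rewrite ?invr_eq0.
by rewrite wt_scale ?invr_eq0 // JZ wtZ mulVf.
Qed.

Lemma aff_elt_lieb x : aff_elt x -> lieb (J x) x = x.
Proof. by case=> -[_ _ h] e; rewrite h e scale1r. Qed.

Lemma aff_elt_V x : aff_elt x -> x \in V.
Proof. by case=> -[]. Qed.

Lemma aff_elt_notin_VJ x : aff_elt x -> x \notin VJ.
Proof.
move=> [[xV _ _] wx]; apply/negP => xVJ; move/eqP: wx.
by rewrite wt_V ?VJ_JV // eq_sym oner_eq0.
Qed.

(** In [skt_VJ] with [y = x], each of the three terms is [q u u]. *)
Lemma aff_elt_fixed_VJ x u : aff_elt x -> u \in VJ -> lieb (J x) u = u -> u = 0.
Proof.
move=> hx uVJ xu; apply: q_eq0.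
by have := skt_VJ uVJ (aff_elt_V hx); rewrite /= (aff_elt_lieb hx) !xu; lra.
Qed.

(* If neither weight vanishes, both are [1] because the elements act as
   idempotents modulo [VJ]; then [y - x] is an eigenvector of [ad (J x)] in
   [VJ] for the eigenvalue [1], which [skt_VJ] forbids. *)
Lemma aff_elt_wt_J x y : aff_elt x -> aff_elt y -> x != y -> wt y (J x) = 0.
Proof.
move=> hx hy nxy; have [[[xV _ wx] _] [[yV _ wy] _]] := (hx, hy).
have idem (a b : R) u w : aff_elt u -> aff_elt w -> lieb (J u) w = a *: w ->
    a *: w - b *: u \in VJ -> a ^+ 2 = a.
  move=> hu hw uw abVJ; have /= := lieb_VJ abVJ (aff_elt_V hu).
  rewrite !liebE uw (aff_elt_lieb hu) => h; have := rpredB h abVJ.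
  rewrite opprB addrA subrK scalerA -scalerBl rpredZeq (negPf (aff_elt_notin_VJ hw)).
  by rewrite orbF subr_eq0 => /eqP.
set a := wt y (J x); set b := wt x (J y).
have ab : a *: y - b *: x \in VJ by rewrite -wx -wy commutator_VJ.
have aa : a ^+ 2 = a by apply: (idem a b x y) => //; rewrite wy.
have bb : b ^+ 2 = b.
  by apply: (idem b a y x); rewrite ?wx // -opprB rpredN.
have [->//|a0] := eqVneq a 0.
have a1 : a = 1 by apply: (mulfI a0); rewrite mulr1 -expr2.
have b1 : b = 1.
  have [b0|b0] := eqVneq b 0; last by apply: (mulfI b0); rewrite mulr1 -expr2.
  move: ab; rewrite a1 b0 scale1r scale0r subr0.
  by rewrite (negPf (aff_elt_notin_VJ hy)).
rewrite a1 b1 !scale1r in ab.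
have /eqP : y - x = 0.
  apply: (aff_elt_fixed_VJ hx ab); rewrite liebDr liebNr (aff_elt_lieb hx) wy.
  by rewrite -/a a1 scale1r.
by rewrite subr_eq0 eq_sym (negPf nxy).
Qed.

(** * The functional [wt x \o J] of one [aff_elt] *)

Section AffElt.
Variable x : g.
Hypothesis hx : aff_elt x.
Let xV : x \in V := aff_elt_V hx.
Let f z := wt x (J z).
Let fD y z : f (y + z) = f y + f z. Proof. by rewrite /f JD wtD. Qed.
Let fN z : f (- z) = - f z. Proof. by rewrite /f JN wtN. Qed.
Let fZ k z : f (k *: z) = k * f z. Proof. by rewrite /f JZ wtZ. Qed.
Let fx : f x = 1. Proof. by case: hx. Qed.
Let fVJ z : z \in VJ -> f z = 0.
Proof. by move=> zVJ; rewrite /f wt_V ?VJ_JV. Qed.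
Let wx y : lieb y x = wt x y *: x. Proof. by case: hx => -[]. Qed.

Let lieb_Jx z : z \in V -> lieb (J x) z - f z *: x \in VJ.
Proof. by move=> zV; rewrite -wx commutator_VJ. Qed.

Let f_lieb_Jx z : z \in V -> f (lieb (J x) z) = f z.
Proof.
move=> zV; have /fVJ := lieb_Jx zV.
by rewrite fD fN fZ fx mulr1 => /eqP; rewrite subr_eq0 => /eqP.
Qed.

(* [1] is not an eigenvalue of [ad (J x)] on [VJ], so [z] lies in the image of
   [ad (J x) - 1], which commutes with [ad y] and is killed by [f]. *)
Let f_lieb_VJ y z : z \in VJ -> f (lieb y z) = 0.
Proof.
pose B := (ad (J x) - \1)%VF.
have BE w : B w = lieb (J x) w - w.
  by rewrite /B lfunE /= opp_lfunE id_lfunE adE.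
have BVJ : (B @: VJ)%VS = VJ.
  apply/eqP; rewrite eqEdim; apply/andP; split.
    by apply/subvP => _ /memv_imgP[w wVJ ->]; rewrite BE rpredB ?lieb_VJ.
  rewrite limg_dim_eq //; apply/eqP; rewrite -subv0; apply/subvP => w.
  rewrite memv_cap memv_ker BE subr_eq0 memv0 => /andP[wVJ /eqP xw].
  by rewrite (aff_elt_fixed_VJ hx wVJ xw).
rewrite -{1}BVJ => /memv_imgP[w wVJ ->].
rewrite BE liebDr liebNr fD fN lieb_comm ?VJ_V // f_lieb_Jx ?lieb_V //.
by rewrite subrr.
Qed.

(** Modulo [VJ], [lieb (J x) z] is [f z *: x]. Apply [ad y] and then [f], which kills the error term
    and ignores [ad (J x)]. *)
Let f_lieb y z : z \in V -> f (lieb y z) = wt x y * f z.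
Proof.
move=> zV; have /(f_lieb_VJ y) := lieb_Jx zV.
rewrite liebDr liebNr liebZr wx fD fN !fZ fx mulr1 lieb_comm // f_lieb_Jx ?lieb_V //.
by move/eqP; rewrite subr_eq0 mulrC => /eqP.
Qed.

(** This makes [aff_core] an ideal. Insert [ad (J x)], which [f] ignores on [V], and use Leibniz;
    integrability at [(x, y)] gives [f (lieb (J x) y) = 0]. *)
Lemma aff_elt_wt_J_lieb a y : wt x y = 0 -> wt x (J y) = 0 ->
  wt x (J (lieb a y)) = 0.
Proof.
move=> y0 Jy0; rewrite -/(f _) -f_lieb_Jx ?lieb_V // lieb_leibniz fD.
rewrite [lieb (lieb _ _) y]liebC fN.
rewrite (f_lieb y (lieb_V _ _)) (f_lieb a (lieb_V _ _)) y0 mul0r oppr0 add0r.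
have := congr1 (wt x) (lieb_JJ x y).
rewrite !wtD !(wt_V xV (lieb_V _ _)) [lieb x (J y)]liebC wx Jy0 scale0r oppr0.
by rewrite (linear0 J) wt0 addr0 add0r /f /wt => <-; rewrite mulr0.
Qed.
End AffElt.

(** Polarisation of [wt_J_square]; the two cross terms agree by [commutator_VJ]. *)
Lemma wt_J_mult v y z : eigv v -> wt v (J v) = 0 -> y \in V -> z \in V ->
  wt v (J (lieb (J y) z)) = - 2 * wt v (J y) * wt v (J z).
Proof.
move=> hv wv yV zV; have := wt_J_square hv wv (rpredD yV zV).
have : wt v (J (lieb (J y) z - lieb (J z) y)) = 0.
  by rewrite wt_V ?VJ_JV ?commutator_VJ //; case: hv.
rewrite !(JE, liebE, wtD, wtN) !wt_J_square // => h1 h2; lra.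
Qed.

(** * The copy of [aff(R)^p] spanned by a complete family *)

Section AffFamily.
Variables (p : nat) (X : 'I_p -> g).
Hypothesis X_aff : forall i, aff_elt (X i).
Hypothesis X_inj : injective X.
Hypothesis X_all : forall x, aff_elt x -> exists i, x = X i.

Lemma aff_family_wt i j : wt (X i) (X j) = 0.
Proof. by rewrite wt_V ?aff_elt_V. Qed.

Lemma aff_family_wt_J i j : wt (X i) (J (X j)) = (i == j)%:R.
Proof.
have [->|nij] := eqVneq i j; first by case: (X_aff j).
by apply: aff_elt_wt_J => //; rewrite (inj_eq X_inj) eq_sym.
Qed.

Lemma aff_family_lieb y j : lieb y (X j) = wt (X j) y *: X j.
Proof. by case: (X_aff j) => -[]. Qed.

Lemma aff_family_lieb_JJ i j : lieb (J (X i)) (J (X j)) = 0.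
Proof.
rewrite lieb_JJ_V ?aff_elt_V // !aff_family_lieb !aff_family_wt_J eq_sym.
by have [->|] := eqVneq; rewrite ?subrr ?scale0r ?subr0 linear0.
Qed.

Local Notation coords := {ffun 'I_p -> aff R}.
Definition aff_map (x : coords) : g :=
  \sum_i ((x i).1 *: X i + (x i).2 *: J (X i)).

Fact aff_map_linear : linear aff_map.
Proof.
move=> k x y; rewrite /aff_map scaler_sumr -big_split; apply: eq_bigr => i _ /=.
by rewrite !ffunE /= !scalerDl !scalerDr !scalerA addrACA.
Qed.

HB.instance Definition _ := GRing.isLinear.Build R coords g *:%R
  aff_map aff_map_linear.

(** The weights of the family and, in [wt_J_aff_map], their composites with [J] recover all
    coordinates. *)
Lemma wt_aff_map (x : coords) j : wt (X j) (aff_map x) = (x j).2.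
Proof.
rewrite /aff_map (big_morph _ (wtD (X j)) (wt0 _)) (bigD1 j) //= big1 => [|i nij].
  by rewrite wtD !wtZ aff_family_wt aff_family_wt_J eqxx mulr0 mulr1 add0r addr0.
by rewrite wtD !wtZ aff_family_wt aff_family_wt_J eq_sym (negPf nij) !mulr0 addr0.
Qed.

Lemma aff_map_J (x : coords) : aff_map (aff_pow_J x) = J (aff_map x).
Proof.
rewrite /aff_map linear_sum; apply: eq_bigr => i _.
by rewrite ffunE /= linearD !linearZ /= JJ scalerN scaleNr addrC.
Qed.

Lemma wt_J_aff_map (x : coords) j : wt (X j) (J (aff_map x)) = (x j).1.
Proof. by rewrite -aff_map_J wt_aff_map ffunE. Qed.

Lemma lieb_aff_map_J (x : coords) j : lieb (aff_map x) (J (X j)) = - (x j).1 *: X j.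
Proof.
rewrite liebC /aff_map linear_sum /= (bigD1 j) //= big1 ?addr0 => [|i nij].
  rewrite !liebE aff_family_lieb_JJ scaler0 addr0 aff_family_lieb.
  by rewrite aff_family_wt_J eqxx scale1r scaleNr.
rewrite !liebE aff_family_lieb_JJ aff_family_lieb aff_family_wt_J (negPf nij).
by rewrite !(scale0r, scaler0) addr0.
Qed.

Lemma aff_map_lieb (x y : coords) : aff_map (lieb x y) = lieb (aff_map x) (aff_map y).
Proof.
rewrite [aff_map y]/aff_map linear_sum; apply: eq_bigr => i _ /=.
rewrite !liebE lieb_aff_map_J aff_family_lieb wt_aff_map ffunE /=.
by rewrite scale0r addr0 !scalerA -scalerDl; congr (_ *: _); ring.
Qed.

Lemma aff_map_inj0 (x : coords) : (forall j, wt (X j) (aff_map x) = 0) ->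
  (forall j, wt (X j) (J (aff_map x)) = 0) -> x = 0.
Proof.
move=> h1 h2; apply/ffunP => j; rewrite ffunE.
have := h1 j; have := h2 j; rewrite wt_aff_map wt_J_aff_map.
by case: (x j) => a b /= -> ->.
Qed.

Lemma aff_family_dim : (p <= \dim {:g})%N.
Proof.
have Xfree : free [tuple X i | i < p].
  apply/freeP => k k0 i; pose x := [ffun j => (k j, 0) : aff R].
  have Fx : aff_map x = 0.
    rewrite -[RHS]k0; apply: eq_bigr => j _.
    by rewrite -tnth_nth tnth_mktuple ffunE /= scale0r addr0.
  by have := wt_J_aff_map x i; rewrite Fx linear0 ffunE /= => <-; rewrite wt0.
have := Xfree; rewrite /free size_tuple => /eqP <-.
by rewrite dimvS ?subvf.
Qed.

(** * The core: common kernel of these weights and of their composites with [J] *)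

Definition aff_core : {vspace g} :=
  (\bigcap_i (lker (ad (X i)) :&: lker (ad (X i) \o J)))%VS.

Lemma wt_aff_eq0 x y : aff_elt x -> (wt x y == 0) = (lieb x y == 0).
Proof.
by case=> -[_ x0 hx] _; rewrite [lieb x y]liebC oppr_eq0 hx scaler_eq0 (negPf x0) orbF.
Qed.

Lemma aff_coreP y :
  reflect (forall i, wt (X i) y = 0 /\ wt (X i) (J y) = 0) (y \in aff_core).
Proof.
rewrite memvE; apply: (iffP subv_bigcapP) => h i.
  have := h i isT; rewrite -memvE memv_cap !memv_ker comp_lfunE !adE.
  by rewrite -!wt_aff_eq0 // => /andP[/eqP-> /eqP->].
have [h1 h2] := h i; rewrite -memvE memv_cap !memv_ker comp_lfunE !adE.
by move=> _; rewrite -!wt_aff_eq0 // h1 h2 eqxx.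
Qed.

Lemma aff_core_J y : y \in aff_core -> J y \in aff_core.
Proof.
move=> /aff_coreP h; apply/aff_coreP => i; have [h1 h2] := h i.
by rewrite JJ wtN h1 oppr0.
Qed.

Lemma aff_core_ideal x y : y \in aff_core -> lieb x y \in aff_core.
Proof.
move=> /aff_coreP h; apply/aff_coreP => i; have [h1 h2] := h i.
by rewrite aff_elt_wt_J_lieb // wt_V ?lieb_V ?aff_elt_V.
Qed.

Lemma eigv_aff_core_aff v y : eigv v -> y \in aff_core ->
  wt v (J v) != 0 -> wt v y = 0.
Proof.
move=> hv /aff_coreP hy wv; have [x /X_all[i ->] <-] := eigv_aff_elt hv wv.
by case: (hy i).
Qed.

(** The [k]-eigenspace of [ad y] in [V] is stable under every [ad z], so it contains a common
    eigenvector. *)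
Lemma eigv_exists y (k : R) w : w \in V -> w != 0 -> lieb y w = k *: w ->
  exists2 v, eigv v & wt v y = k.
Proof.
move=> wV w0 yw; pose W := (V :&: lker (ad y - k *: \1)%VF)%VS.
have inW u : (u \in W) = (u \in V) && (lieb y u == k *: u).
  by rewrite memv_cap memv_ker_ad.
have wW : w \in W by rewrite inW wV yw eqxx.
have [|||v [vW v0 hv]] := @common_ad_eigenvector _ _ roots_ad fullv W.
- by move=> a b u _ _; rewrite inW => /andP[uV _]; apply: lieb_comm.
- move=> a u _; rewrite !inW lieb_V => /andP[uV /eqP yu] /=.
  by rewrite lieb_comm // yu liebZr.
- by apply: contraNneq w0 => W0; rewrite W0 memv0 in wW.
move: vW; rewrite inW => /andP[vV /eqP yv].
exists v; last exact: wtE.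
split=> // z; have [c cE] := hv z (memvf _).
by rewrite (wtE v0 cE).
Qed.

(* Such a weight [f = wt v \o J] satisfies [f \o ad (J y) = -2 f(y) f] on [V],
   so [-2 f(y)] is again an eigenvalue of [ad (J y)], and it comes from a
   weight of the same kind since the weights of the [X i] vanish at [J y].
   Iterating, [ad (J y)] would have infinitely many eigenvalues. *)
Lemma wt_J_aff_core v y : eigv v -> wt v (J v) = 0 -> y \in V ->
  y \in aff_core -> wt v (J y) = 0.
Proof.
move=> hv wv yV yn; apply/eqP/negPn/negP => c0.
have step u : eigv u -> wt u (J u) = 0 -> wt u (J y) != 0 ->
    exists u', [/\ eigv u', wt u' (J u') = 0 & wt u' (J y) = - 2 * wt u (J y)].
  move=> hu wu uy; set k := - 2 * _.
  pose B := (ad (J y) - k *: \1)%VF.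
  have BE w : B w = lieb (J y) w - k *: w.
    by rewrite /B lfunE /= opp_lfunE scale_lfunE id_lfunE adE.
  have BV : (B @: V <= V)%VS.
    by apply/subvP => _ /memv_imgP[w wV ->]; rewrite BE rpredB ?lieb_V ?rpredZ.
  (* If [B] were injective on [V], then [y = B w] for some [w] in [V]; by [wt_J_mult] and the choice
     of [k], the terms of [wt u (J y)] would cancel. *)
  have : (V :&: lker B)%VS != 0%VS.
    apply/eqP => kB; have /limg_dim_eq dB := kB.
    have /eqP VB : (B @: V)%VS == V by rewrite eqEdim BV dB leqnn.
    move: (yV); rewrite -VB => /memv_imgP[w wV yE]; move/eqP: uy; apply.
    rewrite [in J y]yE BE !(JE, wtD, wtN, wtZ) wt_J_mult // /k.
    by rewrite subrr.
  rewrite -vpick0; set w := vpick _ => w0.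
  have : w \in (V :&: lker B)%VS by apply: memv_pick.
  rewrite memv_cap memv_ker_ad => /andP[wV /eqP yw].
  have [u' hu' u'y] := eigv_exists wV w0 yw.
  exists u'; split=> //; apply/eqP/negPn/negP => wu'.
  have /eqP := eigv_aff_core_aff hu' (aff_core_J yn) wu'.
  by rewrite u'y mulf_eq0 oppr_eq0 pnatr_eq0 /= (negPf uy).
have eig k : exists u,
    [/\ eigv u, wt u (J u) = 0 & wt u (J y) = (- 2) ^+ k * wt v (J y)].
  elim: k => [|k [u [hu wu uy]]]; first by exists v; rewrite expr0 mul1r.
  have [|u' [hu' wu' u'y]] := step u hu wu.
    by rewrite uy mulf_neq0 // expf_neq0 // oppr_eq0 pnatr_eq0.
  by exists u'; split=> //; rewrite u'y uy exprS mulrA.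
have [s hs] := roots_ad (J y).
pose l := [seq (- 2) ^+ k * wt v (J y) | k <- iota 0 (size s).+1].
have : (size l <= size s)%N.
  apply: uniq_leq_size.
    rewrite map_inj_uniq ?iota_uniq // => i j /(mulIf c0).
    move/(congr1 Num.norm); rewrite !normrX normrN ger0_norm ?ler0n //.
    by apply: ieexprIn; rewrite ?ltr0n // (eqr_nat R 2 1).
  move=> _ /mapP[k _ ->]; have [u [[_ u0 hu] _ uy]] := eig k.
  by apply: (ad_roots_eigenvalue hs u0); rewrite hu uy.
by rewrite size_map size_iota ltnn.
Qed.

Lemma wt_aff_core v y : eigv v -> y \in aff_core -> wt v y = 0.
Proof.
move=> hv yn; have [wv|wv] := eqVneq (wt v (J v)) 0; last exact: eigv_aff_core_aff.
have := wt_square_le hv wv y.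
rewrite (wt_J_aff_core hv wv (lieb_V y (J y))) ?aff_core_ideal ?aff_core_J // => h.
apply/eqP; rewrite -sqrf_eq0 eq_le sqr_ge0 andbT; apply: le_trans h.
by rewrite lerDl sqr_ge0.
Qed.

(** An eigenvalue of [ad y] on [S] is the value of a weight, hence [0]; but [ad y], being onto [S],
    is injective there. *)
Lemma aff_core_stable y (S : {vspace g}) : y \in aff_core -> (S <= V)%VS ->
  (ad y @: S)%VS = S -> S = 0%VS.
Proof.
move=> yn SV yS; apply/eqP/negPn/negP => S0; have [s hs] := roots_ad y.
have [|w [k [wS w0 yw]]] := ad_roots_eigenvector hs _ S0.
  by move=> w wS; rewrite -yS -adE memv_img.
have [v hv vy] := eigv_exists (subvP SV _ wS) w0 yw.
have k0 : k = 0 by rewrite -vy wt_aff_core.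
have : (S :&: lker (ad y) == 0)%VS.
  by rewrite -dimv_eq0 -(eqn_add2r (\dim (ad y @: S))) limg_ker_dim yS add0n.
move/eqP => ker0; have : w \in (S :&: lker (ad y))%VS.
  by rewrite memv_cap wS memv_ker adE yw k0 scale0r eqxx.
by rewrite ker0 memv0 (negPf w0).
Qed.

(** A form of Nakayama's lemma, by induction on [ys]: one [y] can be discarded because its repeated
    images of [W] shrink to [0]. *)
Lemma sub_sum_ad (ys : seq g) (W : {vspace g}) :
  {subset ys <= aff_core} -> (W <= V)%VS ->
  (forall y, y \in aff_core -> (ad y @: W <= W)%VS) ->
  (W <= \sum_(y <- ys) ad y @: W)%VS -> W = 0%VS.
Proof.
move=> + WV Wst; elim: ys => [_|y ys IH ysn].
  by rewrite big_nil subv0 => /eqP.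
rewrite big_cons; set Z := (\sum_(y <- ys) _)%VS => WZ.
apply: IH => [z zys|]; first by apply: ysn; rewrite inE zys orbT.
rewrite -/Z.
have yn : y \in aff_core by apply: ysn; rewrite mem_head.
have yZ : (ad y @: Z <= Z)%VS.
  rewrite /Z limg_sum; elim/big_ind2: _ => [|A1 A2 B1 B2 hA hB|z _]; rewrite ?addvS //.
  apply/subvP => _ /memv_imgP[_ /memv_imgP[w wW ->] ->].
  rewrite !adE lieb_comm ?(subvP WV) // -!adE memv_img //.
  by apply: (subvP (Wst y yn)); rewrite memv_img.
(* Replacing [S] by [ad y @: S] keeps [W <= Z + S], as [W <= ad y @: W + Z] and [Z] is stable;
   [aff_core_stable] ends the descent at [0]. *)
have key (S : {vspace g}) : (S <= W)%VS -> (ad y @: S <= S)%VS ->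
    (W <= Z + S)%VS -> (W <= Z)%VS.
  have [n] := ubnP (\dim S); elim: n => // n IHn in S *.
  move=> dS SW yS WS; have [E|nE] := eqVneq (ad y @: S)%VS S.
    have S0 := aff_core_stable yn (subv_trans SW WV) E.
    by rewrite S0 addv0 in WS.
  apply: (IHn (ad y @: S)%VS).
  - rewrite -ltnS; apply: leq_trans dS; rewrite ltnS ltn_neqAle dimvS // andbT.
    by apply: contra nE => dE; rewrite eqEdim yS (eqP dE) leqnn.
  - exact: subv_trans yS SW.
  - exact: limgS.
  apply: subv_trans WZ _; rewrite subv_add addvSl andbT.
  apply: subv_trans (limgS _ WS) _; rewrite limgD; apply: addvS => //.
by apply: (key W) => //; [exact: Wst | exact: addvSr].
Qed.

(** The lower central series becomes stationary, and [sub_sum_ad] with a basis of [aff_core] shows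
    that its stable term is zero. *)
Lemma aff_core_nilpotent : lie_nilpotent aff_core.
Proof.
pose L := lower_central_series aff_core.
have LS k : (L k.+1 <= L k)%VS.
  elim: k => [|k IH]; apply/lie_prodv_subP => u v un vL.
    by rewrite /L /= aff_core_ideal.
  by apply/lie_prodv_subP: un (subvP IH _ vL).
(* The condition [0 < k] puts [L k] inside [V]. *)
suff gen n k : (0 < k)%N -> (\dim (L k) < n)%N -> exists m, L m = 0%VS.
  exact: (gen _ 1%N isT (ltnSn _)).
elim: n k => // n IH k k0 dk; have [LE|nE] := eqVneq (L k.+1) (L k); last first.
  apply: (IH k.+1) => //; rewrite -ltnS; apply: leq_trans dk.
  rewrite ltnS ltn_neqAle dimvS // andbT.
  by apply: contra nE => dE; rewrite eqEdim LS (eqP dE) leqnn.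
exists k; apply: (@sub_sum_ad (vbasis aff_core)).
- by move=> y yb; apply: vbasis_mem.
- by case: k k0 {dk LE} => // k _; apply/lie_prodv_subP.
- move=> y yn; apply/subvP => _ /memv_imgP[w wL ->]; rewrite adE -LE.
  exact: lieb_lie_prodv.
rewrite -[X in (X <= _)%VS]LE; apply/span_subvP => _ /allpairsP[[u v] /= [un vL ->]].
rewrite (big_rem u) //=; apply: (subvP (addvSl _ _)).
by rewrite -adE memv_img // vbasis_mem.
Qed.

(** If [wt (X i) y != 0] for some [y] in [m], then [X i] is a multiple of [lieb y (X i)], so it lies
    in [m] and in every term of its lower central series. *)
Lemma aff_core_max m : J_nilpotent_ideal J m -> (m <= aff_core)%VS.
Proof.
case=> idm [k Lk] /subvP Jm; have wtm i y : y \in m -> wt (X i) y = 0.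
  move=> ym; apply/eqP/negPn/negP => wy; have yX := aff_family_lieb y i.
  have Xm : X i \in m.
    rewrite -[X i](scalerK wy) -yX rpredZ // liebC rpredN; exact: idm.
  have XL l : X i \in lower_central_series m l.
    elim: l => //= l IH; rewrite -[X i](scalerK wy) -yX rpredZ //.
    exact: lieb_lie_prodv.
  by have := XL k; rewrite Lk memv0; case: (X_aff i) => -[_ /negPf->].
apply/subvP => y ym; apply/aff_coreP => i.
by rewrite !wtm // Jm // memv_img.
Qed.

Lemma aff_core_is_max : is_max_J_nilpotent_ideal J aff_core.
Proof.
split; last exact: aff_core_max.
split; [exact: aff_core_ideal | exact: aff_core_nilpotent |].
by apply/subvP => _ /memv_imgP[y yn ->]; apply: aff_core_J.
Qed.

Lemma aff_core_semidirect : is_aff_pow_semidirect J p aff_core.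
Proof.
exists (limg (linfun aff_map)).
have imP y : reflect (exists t, y = aff_map t) (y \in limg (linfun aff_map)).
  apply: (iffP memv_imgP) => [[x _ ->]|[x ->]]; exists x; rewrite ?lfunE ?memvf //.
split.
- split.
  + move=> _ _ /imP[x ->] /imP[y ->]; rewrite -aff_map_lieb.
    by apply/imP; exists (lieb x y).
  + apply/subvP => _ /memv_imgP[_ /imP[x ->] ->]; rewrite -aff_map_J.
    by apply/imP; exists (aff_pow_J x).
  exists (linfun aff_map); split=> //.
  + apply/eqP; rewrite -subv0; apply/subvP => x; rewrite memv_ker lfunE memv0 /=.
    move/eqP => x0; apply/eqP/aff_map_inj0 => j; by rewrite x0 ?linear0 wt0.
  + by move=> x y; rewrite !lfunE; apply: aff_map_lieb.
  + by move=> x; rewrite !lfunE; apply: aff_map_J.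
- apply/eqP; rewrite eqEsubv subvf; apply/subvP => y _.
  (* With these coordinates [y] and [aff_map x] have the same weights, also after [J], so they
     differ by an element of the core. *)
  pose x := [ffun j => (wt (X j) (J y), wt (X j) y) : aff R].
  rewrite -[y](subrK (aff_map x)) addrC memv_add //; first by apply/imP; exists x.
  apply/aff_coreP => j; rewrite JD JN !wtD !wtN wt_aff_map wt_J_aff_map !ffunE.
  by rewrite !subrr.
- apply/eqP; rewrite -subv0; apply/subvP => y; rewrite memv_cap memv0.
  case/andP => /imP[x ->] /aff_coreP h; rewrite (aff_map_inj0 (x := x)) ?linear0 //.
    by move=> j; case: (h j).
  by move=> j; case: (h j).
Qed.
End AffFamily.

(** A family of maximal size is complete, since a missing element could be adjoined;
    [aff_family_dim] bounds the size. *)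
Lemma aff_family_exists : exists p (X : 'I_p -> g),
  [/\ forall i, aff_elt (X i), injective X & forall x, aff_elt x -> exists i, x = X i].
Proof.
pose P p := `[< exists X : 'I_p -> g, (forall i, aff_elt (X i)) /\ injective X >].
have P0 : exists p, P p by exists 0%N; apply/asboolP; exists (fun=> 0); split=> -[].
have Pmax p : P p -> (p <= \dim {:g})%N.
  by move=> /asboolP[X [Xa Xi]]; apply: (aff_family_dim Xa Xi).
have [p /asboolP[X [Xa Xi]] pmax] := ex_maxnP P0 Pmax.
exists p, X; split=> // x hx; apply: contrapT => nx.
suff /pmax : P p.+1 by rewrite ltnn.
apply/asboolP; exists (fcons x X); split=> [i|i j].
  by have [k ->|->] := unliftP ord0 i; rewrite ?fcons_lift ?fcons0.
have [k ->|->] := unliftP ord0 i; have [l ->|->] := unliftP ord0 j;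
  rewrite ?fcons_lift ?fcons0 //.
- by move/Xi->.
- by move=> e; case: nx; exists k.
- by move=> e; case: nx; exists l.
Qed.

Lemma two_step_skt_semidirect : exists nJ : {vspace g},
  is_max_J_nilpotent_ideal J nJ /\ exists p, is_aff_pow_semidirect J p nJ.
Proof.
have [p [X [Xa Xi Xall]]] := aff_family_exists.
exists (aff_core X); split; first exact: aff_core_is_max.
by exists p; apply: aff_core_semidirect.
Qed.
End TwoStepSKT.

Theorem theorem4 (R : realType) (g : lieAlgType R) (J : 'End(g))
  (g2step : two_step_solvable g) (guni : unimodular g)
  (gcs : completely_solvable g) (hJ : is_complex_structure J)
  (hSKT : admits_SKT_metric J) :
  exists nJ : {vspace g}, is_max_J_nilpotent_ideal J nJ /\
    exists p : nat, is_aff_pow_semidirect J p nJ.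
Proof.
have [JJ Jint] := hJ; have [q [qJJ dcl]] := hSKT.
apply: (two_step_skt_semidirect (V := lie_prodv fullv fullv) (q := q)) => //.
- by move=> x y; rewrite lieb_lie_prodv ?memvf.
- by move=> x y xV yV; apply/eqP; rewrite -memv0 -g2step lieb_lie_prodv.
- exact: completely_solvable_roots.
- by move=> x y z t; apply: torsion_closed.
Qed.
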